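(* Let $\gamma\in\mathsf M_g$ be a discrete quasi-periodic curve with monodromy $g=(R,\vec b)\in\mathrm{SE}(3)$, where $g$ is not a pure half-turn and the origin is chosen on the screw axis if $R\ne\mathrm{Id}$. The monodromy-compatible components of $\mathsf A(\gamma)$ and $\mathsf V(\gamma)$, namely - the full vectors $\mathsf A$ and $\mathsf V$ if $g=\mathrm{id}$, - the full vector $\mathsf A$ and $\langle\vec s_g,\mathsf V\rangle$ if $R=\mathrm{Id}$, $\vec b\ne0$, - $\langle\vec s_g,\mathsf A\rangle$ and $\langle\vec s_g,\mathsf V\rangle$ if $R\neq\mathrm{Id}$, are independent of the chosen discrete fundamental domain $\{k+1,\dots,k+N\}$, $k\in\mathbb Z$. Moreover, for $h=(Q,\vec c)\in Z(g)$ they transform exactly as follows: (i) If $g=\mathrm{id}$ (any $h\in\mathrm{SE}(3)$ is allowed): $\mathsf A(h\circ\gamma)=Q\mathsf A(\gamma)$ and $\mathsf V(h\circ\gamma)=Q\mathsf V(\gamma)+\vec c\times Q\mathsf A(\gamma)$; that is, for closed polygons the full pair $(\mathsf V,\mathsf A)$ transforms by the coadjoint action of $\mathrm{SE}(3)$. (ii) If $R=\mathrm{Id}$, $\vec b\neq0$ (so $Q\vec s_g=\vec s_g$ and $\vec c\in\mathbb R^3$ is arbitrary), with $\vec c^\perp=\vec c-\langle\vec s_g,\vec c\rangle\vec s_g$: $\mathsf A(h\circ\gamma)=Q\mathsf A(\gamma)+\vec c\times\vec b$ and $\langle\vec s_g,\mathsf V(h\circ\gamma)\rangle=\langle\vec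 s_g,Q\mathsf V(\gamma)+\vec c\times Q\mathsf A(\gamma)\rangle-\tfrac12|\vec b|\,|\vec c^\perp|^2$; the two additional terms $\vec c\times\vec b$ and $-\tfrac12|\vec b||\vec c^\perp|^2$ vanish when $\vec c\parallel\vec s_g$. (iii) If $R\neq\mathrm{Id}$ (so $h$ must be a screw motion about $\mathbb R\vec s_g$, i.e. $Q\vec s_g=\vec s_g$ and $\vec c\parallel\vec s_g$): $\langle\vec s_g,\mathsf A(h\circ\gamma)\rangle=\langle\vec s_g,Q\mathsf A(\gamma)\rangle$ and $\langle\vec s_g,\mathsf V(h\circ\gamma)\rangle=\langle\vec s_g,Q\mathsf V(\gamma)+\vec c\times Q\mathsf A(\gamma)\rangle$.
   Context: Fix an integer $N\ge3$. An element $g=(R,\vec b)\in\mathrm{SE}(3)$ acts on $\mathbb R^3$ by $g(\vec x)=R\vec x+\vec b$. A discrete quasi-periodic curve with monodromy $g$ is a map $\gamma:\mathbb Z\to\mathbb R^3$, $i\mapsto\vec\gamma_i$, with $\vec\gamma_{i+N}=g(\vec\gamma_i)$ for all $i$; $\mathsf M_g$ is the space of all such curves. $Z(g)=\{h\in\mathrm{SE}(3):hg=gh\}$ acts vertexwise. A pure half-turn is a rotation by angle $\pi$ about an axis with no translation along it. If $R\ne\mathrm{Id}$, the origin is chosen on the screw axis of $g$, so that $R\vec b=\vec b$; $\vec s_g$ is a unit vector with $R\vec s_g=\vec s_g$, and $\vec b$ is parallel to $\vec s_g$. If $R=\mathrm{Id},\vec b\neq0$, then $\vec s_g=\vec b/|\vec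 b|$. Discrete area and volume vectors on the fundamental domain $\{1,\dots,N\}$: $$\mathsf A(\gamma)=\tfrac12\sum_{i=1}^N\vec\gamma_i\times\vec\gamma_{i+1}-\tfrac12\vec b\times\vec\gamma_1,$$ $$\mathsf V(\gamma)=\tfrac13\sum_{i=1}^N\tfrac{\vec\gamma_i+\vec\gamma_{i+1}}2\times(\vec\gamma_i\times\vec\gamma_{i+1})-\tfrac16\vec\gamma_1\times(\vec b\times\vec\gamma_1).$$ On the fundamental domain $\{k+1,\dots,k+N\}$ the sums run over $i=k+1,\dots,k+N$ and $\vec\gamma_1$ is replaced by $\vec\gamma_{k+1}$. The coadjoint action of $\mathrm{SE}(3)$ on $\mathfrak{se}(3)^*\cong\mathbb R^3\times\mathbb R^3$ is $\mathrm{Ad}^*_{(Q,\vec c)}(\vec l,\vec p)=(Q\vec l+\vec c\times Q\vec p,\;Q\vec p)$. *)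

(* Defs.v *)
From HB Require Import structures.
From mathcomp Require Import all_boot all_order all_algebra.
From mathcomp Require Import classical_sets reals trigo.

Set Implicit Arguments.
Unset Strict Implicit.
Unset Printing Implicit Defensive.

Import Order.TTheory GRing.Theory Num.Theory.
Local Open Scope ring_scope.

(* Vectors of R^3 are columns, so that matrices act by [*m].  The norm notation
   of MathComp-Analysis is the sup norm on matrices; [enorm] is the Euclidean
   one. *)
Section Euclidean3.
Variable R : realType.
Implicit Types u v : 'cV[R]_3.

Definition dot u v : R := \sum_i u i 0 * v i 0.

Definition enorm u : R := Num.sqrt (dot u u).

(* Indices are added in 'I_3, i.e. modulo 3. *)
Definition cross u v : 'cV[R]_3 :=
  \col_(i < 3) (u (i + 1) 0 * v (i + 2) 0 - u (i + 2) 0 * v (i + 1) 0).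

Lemma crossE u v :
  [/\ cross u v 0 0 = u 1 0 * v 2 0 - u 2 0 * v 1 0,
      cross u v 1 0 = u 2 0 * v 0 0 - u 0 0 * v 2 0 &
      cross u v 2 0 = u 0 0 * v 1 0 - u 1 0 * v 0 0].
Proof.
have e (i j : 'I_3) : val i = val j -> i = j by apply: val_inj.
by split; rewrite mxE; congr (_ * _ - _ * _); (congr (u _ _) || congr (v _ _));
  apply: e.
Qed.

(* Rotation by the angle [t] about the line directed by the unit vector [u]
   through the origin (Rodrigues' formula). *)
Definition axis_rot u (t : R) (x : 'cV[R]_3) : 'cV[R]_3 :=
  cos t *: x + sin t *: cross u x + ((1 - cos t) * dot u x) *: u.

Definition parallel v u := exists a : R, v = a *: u.

(* Component of [v] orthogonal to the unit vector [u]. *)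
Definition perp_part u v : 'cV[R]_3 := v - dot u v *: u.

End Euclidean3.

Section SE3.
Variable R : realType.

Definition SO3 (Q : 'M[R]_3) : bool := (Q *m Q^T == 1%:M) && (\det Q == 1).

Definition SE3 := {h : 'M[R]_3 * 'cV[R]_3 | SO3 h.1}.
HB.instance Definition _ := Choice.on SE3.

Definition rotpart (h : SE3) : 'M[R]_3 := (val h).1.
Definition transpart (h : SE3) : 'cV[R]_3 := (val h).2.

Lemma SO3_1 : SO3 1%:M.
Proof. by rewrite /SO3 trmx1 mulmx1 det1 !eqxx. Qed.

Lemma SO3_mul P Q : SO3 P -> SO3 Q -> SO3 (P *m Q).
Proof.
move=> /andP[/eqP oP /eqP dP] /andP[/eqP oQ /eqP dQ].
by rewrite /SO3 trmx_mul mulmxA -(mulmxA P) oQ mulmx1 oP det_mulmx dP dQ mulr1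
  !eqxx.
Qed.

Lemma SO3_tr P : SO3 P -> SO3 P^T.
Proof.
by move=> /andP[/eqP oP dP]; rewrite /SO3 trmxK (mulmx1C oP) det_tr dP eqxx.
Qed.

Lemma rot_SO3 h : SO3 (rotpart h). Proof. exact: valP h. Qed.

Definition SE3_one : SE3 := exist _ (1%:M, 0) SO3_1.
Definition SE3_mul (h k : SE3) : SE3 :=
  exist _ (rotpart h *m rotpart k, rotpart h *m transpart k + transpart h)
    (SO3_mul (rot_SO3 h) (rot_SO3 k)).
Definition SE3_inv (h : SE3) : SE3 :=
  exist _ ((rotpart h)^T, - ((rotpart h)^T *m transpart h)) (SO3_tr (rot_SO3 h)).

Lemma SE3_mulA : associative SE3_mul.
Proof.
move=> h k l; apply: val_inj; rewrite /= /rotpart /transpart /=.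
by rewrite mulmxA mulmxDr mulmxA addrA.
Qed.

Lemma SE3_mul1 : left_id SE3_one SE3_mul.
Proof.
move=> h; apply: val_inj; rewrite /= /rotpart /transpart /= !mul1mx addr0.
by case: (val h).
Qed.

Lemma SE3_mulV : left_inverse SE3_one SE3_inv SE3_mul.
Proof.
move=> h; apply: val_inj; rewrite /= {1 3}/rotpart /transpart /= subrr.
by have /andP[/eqP /mulmx1C -> _] := rot_SO3 h.
Qed.

Lemma SE3_mulr1 : right_id SE3_one SE3_mul.
Proof.
move=> h; apply: val_inj; rewrite /= /rotpart /transpart /= mulmx1 mulmx0 add0r.
by case: (val h).
Qed.

Lemma SE3_mulrV : right_inverse SE3_one SE3_inv SE3_mul.
Proof.
move=> h; apply: val_inj; rewrite /= /rotpart /transpart /= mulmxN mulmxA.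
by have /andP[/eqP -> _] := rot_SO3 h; rewrite mul1mx addNr.
Qed.

HB.instance Definition _ := isGroup.Build SE3
  SE3_mulA SE3_mul1 SE3_mulr1 SE3_mulV SE3_mulrV.

Definition SE3_act (h : SE3) (x : 'cV[R]_3) : 'cV[R]_3 := rotpart h *m x + transpart h.

Lemma SE3_actM (h k : SE3) x : SE3_act (h * k)%g x = SE3_act h (SE3_act k x).
Proof. by rewrite /SE3_act /rotpart /transpart /= mulmxDr mulmxA addrA. Qed.

(* Z(g) *)
Definition centralizer (g : SE3) : set SE3 := [set h | commute h g]%classic.

(* [p] is a point of the rotation axis and [u] its direction. *)
Definition pure_half_turn (g : SE3) : Prop :=
  exists p u : 'cV[R]_3, enorm u = 1 /\
    forall x, SE3_act g x = p + axis_rot u pi (x - p).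

(* The possible values of s_g.  It is unique up to sign when the rotation part
   of [g] is nontrivial; there is no condition when [g] is the identity. *)
Definition screw_direction (g : SE3) (s : 'cV[R]_3) : Prop :=
  (rotpart g <> 1%:M -> enorm s = 1 /\ rotpart g *m s = s) /\
  (rotpart g = 1%:M -> transpart g <> 0 -> s = (enorm (transpart g))^-1 *: transpart g).

(* Ad^* on pairs (l, p). *)
Definition coadjoint (h : SE3) (m : 'cV[R]_3 * 'cV[R]_3) :
    'cV[R]_3 * 'cV[R]_3 :=
  (rotpart h *m m.1 + cross (transpart h) (rotpart h *m m.2), rotpart h *m m.2).

End SE3.

Section QuasiPeriodic.
Variables (R : realType) (N : nat) (g : SE3 R).

(* M_g *)
Definition quasi_periodic : set (int -> 'cV[R]_3) :=
  [set x | forall i : int, x (i + N%:Z) = SE3_act g (x i)]%classic.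

Lemma quasi_periodic_act (h : SE3 R) (x : int -> 'cV[R]_3) :
  centralizer g h -> quasi_periodic x -> quasi_periodic (SE3_act h \o x).
Proof. by move=> hg qx i; rewrite /= qx -!SE3_actM hg. Qed.

(* Area and volume vectors computed on the fundamental domain
   {k + 1, ..., k + N}. *)
Definition area_on (k : int) (x : int -> 'cV[R]_3) : 'cV[R]_3 :=
  2^-1 *: (\sum_(1 <= i < N.+1) cross (x (k + i%:Z)) (x (k + i%:Z + 1)))
  - 2^-1 *: cross (transpart g) (x (k + 1)).

Definition volume_on (k : int) (x : int -> 'cV[R]_3) : 'cV[R]_3 :=
  3^-1 *: (\sum_(1 <= i < N.+1)
             cross (2^-1 *: (x (k + i%:Z) + x (k + i%:Z + 1)))
                   (cross (x (k + i%:Z)) (x (k + i%:Z + 1))))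
  - 6^-1 *: cross (x (k + 1)) (cross (transpart g) (x (k + 1))).

Definition area (x : int -> 'cV[R]_3) := area_on 0 x.
Definition volume (x : int -> 'cV[R]_3) := volume_on 0 x.

End QuasiPeriodic.

(* Main.v *)
Require Import Defs.
From HB Require Import structures.
From mathcomp Require Import all_boot all_order all_algebra.
From mathcomp Require Import classical_sets reals trigo.
From mathcomp Require Import ring lra.
Set Implicit Arguments.
Unset Strict Implicit.
Unset Printing Implicit Defensive.

Import Order.TTheory GRing.Theory Num.Theory.
Local Open Scope ring_scope.

(** Both vectors are sums over edges of a function of the two endpoints, plus a
    boundary term at the first vertex of the fundamental domain. Applying
    a rigid motion [x |-> Q x + c] to an edge [(x, y)] rotates its contribution
    up to a term linear in [cross c (Q (cross x y))], which sums to the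
    coadjoint term [cross c (Q A)], and a difference of values of one function
    at [y] and at [x], which telescopes ([cross_edge_act],
    [edge_volume_act]). Hence [area] and [volume] of the moved curve differ
    from their expected values by an explicit expression in the first vertex
    [z] of the moved curve before translation and its successor [z'] by one
    period ([area_act], [volume_act]); what remains is to evaluate this
    expression when [z'] is the image of [z] under the monodromy.

    If the monodromy is a translation by [b], the component of that expression
    along [b] does not depend on [z] ([dot_volume_defect_translation]). If it is
    a screw motion, every motion involved preserves the axis, and the
    component along the axis only involves squared distances to the axis
    ([dot_volume_defect_screw]), which all these motions preserve
    ([axis_dist2_rot], [axis_dist2_shift]).

    Moving the fundamental domain by one step replaces the edge from [x] to [y]
    by its image under the monodromy, so the same edge formulas, applied to the
    monodromy itself, give independence of the domain ([dot_area_on_shift],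
    [dot_volume_on_shift]).

    The centralizer of a screw motion is found from the fact that the vectors
    fixed by a nontrivial rotation [P] form a line ([rot_fixed_axis]). A rotation
    commuting with [P] maps this axis to itself; if it reverses it, it reverses
    the axial vector of [P - P^T], which on the other hand it must fix. Then
    [P] is symmetric, a half-turn ([rot_reversed_axis]). Reversal of the axis
    also forces the translation part along it to vanish, so that the
    monodromy is a pure half-turn, which is excluded. *)

(** * Vector algebra in coordinates *)

Section Coordinates.
Variable R : realType.
Implicit Types (u v w x : 'cV[R]_3) (Q : 'M[R]_3).

Lemma vec3P u v :
  u 0 0 = v 0 0 -> u 1 0 = v 1 0 -> u 2 0 = v 2 0 -> u = v.
Proof.
move=> e0 e1 e2; apply/colP => -[[|[|[|//]]] lti].
- by rewrite [Ordinal _](_ : _ = 0) //; apply: val_inj.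
- by rewrite [Ordinal _](_ : _ = 1) //; apply: val_inj.
- by rewrite [Ordinal _](_ : _ = 2) //; apply: val_inj.
Qed.

Lemma sum3E (F : 'I_3 -> R) : \sum_i F i = F 0 + F 1 + F 2.
Proof.
rewrite !big_ord_recl big_ord0 addr0 addrA.
by congr (_ + F _ + F _); apply: val_inj.
Qed.

Lemma dotE u v : dot u v = u 0 0 * v 0 0 + u 1 0 * v 1 0 + u 2 0 * v 2 0.
Proof. exact: sum3E. Qed.

Lemma cross0E u v : cross u v 0 0 = u 1 0 * v 2 0 - u 2 0 * v 1 0.
Proof. by case: (crossE u v). Qed.

Lemma cross1E u v : cross u v 1 0 = u 2 0 * v 0 0 - u 0 0 * v 2 0.
Proof. by case: (crossE u v). Qed.

Lemma cross2E u v : cross u v 2 0 = u 0 0 * v 1 0 - u 1 0 * v 0 0.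
Proof. by case: (crossE u v). Qed.

Lemma addvE u v i j : (u + v) i j = u i j + v i j. Proof. exact: mxE. Qed.
Lemma oppvE u i j : (- u) i j = - u i j. Proof. exact: mxE. Qed.
Lemma scalevE (a : R) u i j : (a *: u) i j = a * u i j. Proof. exact: mxE. Qed.
Lemma zerovE i j : (0 : 'cV[R]_3) i j = 0. Proof. exact: mxE. Qed.

End Coordinates.

(** Matrix products are deliberately left alone: the entries of [Q *m x] are
    atoms for the tactics below. *)
Definition coordE := (addvE, oppvE, scalevE, zerovE, cross0E, cross1E, cross2E).

Ltac coords := repeat (apply: vec3P); rewrite ?dotE ?coordE.
Ltac vfield := coords; by field.

Section VectorAlgebra.
Variable R : realType.
Implicit Types (a : R) (s u v w : 'cV[R]_3).

Lemma dotDr s u v : dot s (u + v) = dot s u + dot s v. Proof. vfield. Qed.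
Lemma dotZr s a u : dot s (a *: u) = a * dot s u. Proof. vfield. Qed.
Lemma dotNr s u : dot s (- u) = - dot s u. Proof. vfield. Qed.
Lemma crossDr u v w : cross u (v + w) = cross u v + cross u w.
Proof. vfield. Qed.
Lemma crossZr u a v : cross u (a *: v) = a *: cross u v. Proof. vfield. Qed.
Lemma crossv0 u : cross u 0 = 0. Proof. vfield. Qed.
Lemma cross0v u : cross 0 u = 0. Proof. vfield. Qed.

Lemma dotv_ge0 u : 0 <= dot u u.
Proof. by rewrite dotE; nra. Qed.

Lemma dotv_eq0 u : dot u u = 0 -> u = 0.
Proof.
rewrite dotE => e; coords; nra.
Qed.

Lemma dot_ext u v : (forall w, dot w u = dot w v) -> u = v.
Proof.
move=> e; apply/eqP; rewrite -subr_eq0; apply/eqP/dotv_eq0.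
by rewrite dotDr dotNr e subrr.
Qed.

Lemma sqr_enorm u : enorm u ^+ 2 = dot u u.
Proof. by rewrite sqr_sqrtr // dotv_ge0. Qed.

End VectorAlgebra.

(** * Rotations *)

Section Rotations.
Variable R : realType.
Implicit Types (a s u v w x y : 'cV[R]_3) (P Q : 'M[R]_3).

Lemma det2E (M : 'M[R]_2) : \det M = M 0 0 * M 1 1 - M 1 0 * M 0 1.
Proof.
rewrite (expand_det_col _ 0) !big_ord_recl big_ord0 addr0 /cofactor !det_mx11.
rewrite !mxE /= expr0 expr1 mul1r mulN1r mulrN.
by congr (_ - _); congr (M _ _ * M _ _); apply: val_inj.
Qed.

Lemma det3E Q : \det Q =
  Q 0 0 * (Q 1 1 * Q 2 2 - Q 2 1 * Q 1 2)
  - Q 1 0 * (Q 0 1 * Q 2 2 - Q 2 1 * Q 0 2)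
  + Q 2 0 * (Q 0 1 * Q 1 2 - Q 1 1 * Q 0 2).
Proof.
have l00 : lift (0 : 'I_3) (0 : 'I_2) = 1 by apply: val_inj.
have l01 : lift (0 : 'I_3) (1 : 'I_2) = 2 by apply: val_inj.
have l10 : lift (1 : 'I_3) (0 : 'I_2) = 0 by apply: val_inj.
have l11 : lift (1 : 'I_3) (1 : 'I_2) = 2 by apply: val_inj.
have l20 : lift (2 : 'I_3) (0 : 'I_2) = 0 by apply: val_inj.
have l21 : lift (2 : 'I_3) (1 : 'I_2) = 1 by apply: val_inj.
rewrite (expand_det_col _ 0) sum3E /cofactor !det2E !mxE.
rewrite ?(l00, l01, l10, l11, l20, l21) /=; ring.
Qed.

(** The triple product is the determinant of its three arguments. *)
Lemma triple_mulmx Q u v w :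
  dot (Q *m w) (cross (Q *m u) (Q *m v)) = \det Q * dot w (cross u v).
Proof. rewrite !dotE !coordE det3E !mxE !sum3E; ring. Qed.

Lemma dot_mulmxl Q u v : dot (Q *m u) v = dot u (Q^T *m v).
Proof. rewrite !dotE !mxE !sum3E !mxE; ring. Qed.

Lemma rot_mulmxT Q : SO3 Q -> Q *m Q^T = 1%:M.
Proof. by case/andP => /eqP. Qed.

Lemma rot_mulTmx Q : SO3 Q -> Q^T *m Q = 1%:M.
Proof. by move/rot_mulmxT/mulmx1C. Qed.

Lemma dot_rot Q u v : SO3 Q -> dot (Q *m u) (Q *m v) = dot u v.
Proof. by move=> rQ; rewrite dot_mulmxl mulmxA rot_mulTmx // mul1mx. Qed.

(** Tested against a vector [Q *m w], both sides give the triple product of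
    [w], [u], [v], because [\det Q = 1]. *)
Lemma cross_rot Q u v :
  SO3 Q -> cross (Q *m u) (Q *m v) = Q *m cross u v.
Proof.
move=> rQ; apply: dot_ext => w.
have -> : w = Q *m (Q^T *m w) by rewrite mulmxA rot_mulmxT // mul1mx.
rewrite triple_mulmx dot_rot //.
by case/andP: rQ => _ /eqP ->; rewrite mul1r.
Qed.

Lemma dot_rot_fixed Q s x : SO3 Q -> Q *m s = s -> dot s (Q *m x) = dot s x.
Proof. by move=> rQ Qs; rewrite -{1}Qs dot_rot. Qed.

Lemma mulmx_fix P : (forall x, P *m x = x) -> P = 1%:M.
Proof.
move=> Px; apply/matrixP => i j.
have : col j P = col j 1%:M by rewrite !colE Px mul1mx.
by move/matrixP/(_ i 0); rewrite !mxE.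
Qed.

(** Coordinates of [x] in the frame [u], [v], [cross u v], multiplied by the Gram
    determinant of [u] and [v] so that no independence is needed. *)
Lemma frame_expansion u v x :
  dot (cross u v) (cross u v) *: x =
    dot x (cross v (cross u v)) *: u + dot x (cross (cross u v) u) *: v
    + dot x (cross u v) *: cross u v.
Proof. vfield. Qed.

(** If [s] and [v] were independent, they would form with their cross product
    a basis of fixed vectors. *)
Lemma rot_fixed_axis P s v : SO3 P -> P <> 1%:M -> dot s s = 1 ->
  P *m s = s -> P *m v = v -> v = dot s v *: s.
Proof.
move=> rP P1 s1 Ps Pv.
have c0 : cross s v = 0.
  apply: dotv_eq0; case: (eqVneq (dot (cross s v) (cross s v)) 0) => // n0.
  case: P1; apply: mulmx_fix => x; apply: (scalerI n0).
  rewrite scalemxAr frame_expansion !mulmxDr -!scalemxAr Ps Pv.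
  by rewrite -cross_rot // Ps Pv.
have : cross s (cross s v) = dot s v *: s - dot s s *: v by vfield.
by rewrite c0 crossv0 s1 scale1r => /esym/eqP; rewrite subr_eq0 => /eqP.
Qed.

Lemma axial_vector P : exists a, forall x, (P - P^T) *m x = cross a x.
Proof.
exists (\col_i [:: P 2 1 - P 1 2; P 0 2 - P 2 0; P 1 0 - P 0 1]`_i) => x.
by apply: vec3P; rewrite !coordE !mxE !sum3E !mxE /=; ring.
Qed.

Lemma commute_trmx P Q : SO3 P -> Q *m P = P *m Q -> Q *m P^T = P^T *m Q.
Proof.
move=> rP QP.
rewrite -[LHS]mul1mx -(rot_mulTmx rP) -!mulmxA (mulmxA P) -QP -mulmxA.
by rewrite rot_mulmxT // mulmx1.
Qed.

(** Two coordinate directions suffice to recover a vector from its cross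
    products. *)
Lemma cross_inj u v : (forall y, cross u y = cross v y) -> u = v.
Proof.
move=> e; apply/eqP; rewrite -subr_eq0; apply/eqP/dotv_eq0.
have {}e y : cross y (u - v) = 0.
  have -> : cross y (u - v) = cross v y - cross u y by vfield.
  by rewrite e subrr.
have e0 : (cross (\col_i (i == 0)%:R) (u - v)) = 0 by exact: e.
have e1 : (cross (\col_i (i == 1)%:R) (u - v)) = 0 by exact: e.
have := (congr1 (fun m : 'cV[R]_3 => m 1 0) e0,
         congr1 (fun m : 'cV[R]_3 => m 2 0) e0,
         congr1 (fun m : 'cV[R]_3 => m 2 0) e1).
rewrite !coordE !dotE !mxE /= => -[[h0 h1] h2]; nra.
Qed.

(** A rotation commuting with [P] commutes with [P - P^T], which is the cross
    product with [a]; since rotations preserve cross products, it carries [a] to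
    a vector with the same cross products. *)
Lemma axial_vector_fixed P Q a : SO3 P -> SO3 Q -> Q *m P = P *m Q ->
  (forall x, (P - P^T) *m x = cross a x) -> Q *m a = a.
Proof.
move=> rP rQ QP Pa; apply: cross_inj => y.
have {1}-> : y = Q *m (Q^T *m y) by rewrite mulmxA rot_mulmxT // mul1mx.
rewrite cross_rot // -Pa -Pa !mulmxA.
rewrite mulmxBr QP (commute_trmx rP QP) -mulmxBl -[_ *m Q *m Q^T]mulmxA.
by rewrite rot_mulmxT // mulmx1.
Qed.

(** The axial vector of [P] is fixed by both [P] and [Q]; fixed by [P], it lies
    on the axis, which [Q] reverses, so it vanishes and [P] is an involution.
    Then [x + P *m x] is fixed by [P], hence on the axis. *)
Lemma rot_reversed_axis P Q s : SO3 P -> SO3 Q -> P <> 1%:M -> dot s s = 1 ->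
  P *m s = s -> Q *m P = P *m Q -> Q *m s = - s ->
  forall x, P *m x = - x + (2 * dot s x) *: s.
Proof.
move=> rP rQ P1 s1 Ps QP Qs x.
have [a Pa] := axial_vector P.
have Qa := axial_vector_fixed rP rQ QP Pa.
have Ra := axial_vector_fixed rP rP erefl Pa.
have as_ := rot_fixed_axis rP P1 s1 Ps Ra.
have aN : a = - a by rewrite -{1}Qa as_ -scalemxAr Qs scalerN.
have a0 : a = 0.
  apply: vec3P; rewrite zerovE.
  - by have := congr1 (fun m : 'cV[R]_3 => m 0 0) aN; rewrite /= oppvE; lra.
  - by have := congr1 (fun m : 'cV[R]_3 => m 1 0) aN; rewrite /= oppvE; lra.
  - by have := congr1 (fun m : 'cV[R]_3 => m 2 0) aN; rewrite /= oppvE; lra.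
have PT : P *m x = P^T *m x.
  by apply/eqP; rewrite -subr_eq0 -mulmxBl Pa a0 cross0v.
have PP : P *m (P *m x) = x by rewrite PT mulmxA rot_mulmxT // mul1mx.
have fx : P *m (x + P *m x) = x + P *m x by rewrite mulmxDr PP addrC.
have := rot_fixed_axis rP P1 s1 Ps fx.
rewrite dotDr dot_rot_fixed // => e.
by rewrite -[P *m x](addKr x) e mulr_natl mulr2n.
Qed.

End Rotations.

(** * Centralizers *)

Section Centralizers.
Variable R : realType.
Implicit Types (g h : SE3 R) (s : 'cV[R]_3).

Lemma centralizerP g h : centralizer g h <->
  rotpart h *m rotpart g = rotpart g *m rotpart h /\
  rotpart h *m transpart g + transpart h
    = rotpart g *m transpart h + transpart g.
Proof.
split=> [/(congr1 val)[]|[e1 e2]] //.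
by apply: val_inj; rewrite /= e1 e2.
Qed.

Lemma centralizer_translation g h : rotpart g = 1%:M ->
  centralizer g h <-> rotpart h *m transpart g = transpart g.
Proof.
move=> g1; rewrite centralizerP g1 mulmx1 !mul1mx addrC.
by split=> [[_ /addrI]|->].
Qed.

(** The rotation part of [h] maps the axis to itself. If it reversed it, then
    comparing the components of the two translation parts along the axis
    would give [transpart g = 0], and [g] would be a half-turn about the axis
    through the origin. *)
Lemma centralizer_screw g h s : ~ pure_half_turn g ->
  rotpart g <> 1%:M -> rotpart g *m transpart g = transpart g ->
  enorm s = 1 -> rotpart g *m s = s -> centralizer g h ->
  rotpart h *m s = s /\ parallel (transpart h) s.
Proof.
move=> ght g1 gb ns gs /centralizerP[hg hb].
have s1 : dot s s = 1 by rewrite -sqr_enorm ns expr1n.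
have rg := rot_SO3 g; have rh := rot_SO3 h.
have fs : rotpart g *m (rotpart h *m s) = rotpart h *m s.
  by rewrite mulmxA -hg -mulmxA gs.
have hs := rot_fixed_axis rg g1 s1 gs fs.
have bs := rot_fixed_axis rg g1 s1 gs gb.
have : dot (rotpart h *m s) (rotpart h *m s) = 1 by rewrite dot_rot.
rewrite {1 2}hs dotZr [dot (_ *: s) s](_ : _ = dot s (rotpart h *m s) * dot s s);
  last by vfield.
rewrite s1 mulr1 -expr2 => /eqP; rewrite sqrf_eq1 => /orP[] /eqP e.
  have hs1 : rotpart h *m s = s by rewrite hs e scale1r.
  split=> //; exists (dot s (transpart h)).
  apply: (rot_fixed_axis rg g1 s1 gs).
  move: hb; rewrite {1}bs -scalemxAr hs1 -bs addrC => /addIr.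
  by move=> <-.
have hs1 : rotpart h *m s = - s by rewrite hs e scaleN1r.
have sb0 : dot s (transpart g) = 0.
  have := congr1 (dot s) hb.
  rewrite {1}bs -scalemxAr hs1 !dotDr (dot_rot_fixed _ rg gs) dotZr dotNr s1.
  by move=> e'; lra.
have b0 : transpart g = 0 by rewrite bs sb0 scale0r.
case: ght; exists 0, s; split=> // x.
rewrite /SE3_act b0 addr0 subr0 add0r /axis_rot cospi sinpi scale0r addr0.
rewrite (rot_reversed_axis rg rh g1 s1 gs hg hs1) scaleN1r.
by congr (_ + _ *: _); ring.
Qed.

End Centralizers.

(** * Edge contributions under a rigid motion *)

Section Edges.
Variable R : realType.
Implicit Types (a : R) (s x y z c : 'cV[R]_3) (Q : 'M[R]_3).

Definition edge_volume x y : 'cV[R]_3 :=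
  cross (2^-1 *: (x + y)) (cross x y).

(** The function whose increments along the edges make up the telescoping part
    of the change of [edge_volume] under a translation by [c]. *)
Definition volume_potential c z : 'cV[R]_3 :=
  2^-1 *: cross z (cross c z) + cross c (cross c z).

Lemma cross_edge_act Q c x y : SO3 Q ->
  cross (Q *m x + c) (Q *m y + c) =
    Q *m cross x y + (cross c (Q *m y) - cross c (Q *m x)).
Proof. by move=> rQ; rewrite -cross_rot //; vfield. Qed.

(** With [X = Q x] and [Y = Q y], expanding the left-hand side gives one term
    [cross c (cross X Y)] directly, and half of another one from
    [2^-1 *: cross (X + Y) (cross c (Y - X))], which equals
    [2^-1 *: cross c (cross X Y)] up to a difference of values at [Y] and [X].
    The factor [3/2] cancels the normalizations [3^-1] of the volume and [2^-1] of
    the area. *)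
Lemma edge_volume_act Q c x y : SO3 Q ->
  edge_volume (Q *m x + c) (Q *m y + c) =
    Q *m edge_volume x y + (3 / 2) *: cross c (Q *m cross x y)
    + (volume_potential c (Q *m y) - volume_potential c (Q *m x)).
Proof.
move=> rQ; rewrite /edge_volume /volume_potential.
rewrite -!cross_rot // -scalemxAr mulmxDr.
by vfield.
Qed.

(** For a unit vector [s], the squared distance from [z] to the line directed
    by [s] through the origin. *)
Definition axis_dist2 s z : R := dot s (cross z (cross s z)).

Lemma axis_dist2E s z : axis_dist2 s z = dot s s * dot z z - dot s z ^+ 2.
Proof. by rewrite /axis_dist2; vfield. Qed.

Lemma axis_dist2_rot Q s z : SO3 Q -> Q *m s = s ->
  axis_dist2 s (Q *m z) = axis_dist2 s z.
Proof. by move=> rQ Qs; rewrite !axis_dist2E (dot_rot_fixed _ rQ Qs) dot_rot. Qed.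

Lemma axis_dist2_shift s z a : axis_dist2 s (z + a *: s) = axis_dist2 s z.
Proof. by rewrite /axis_dist2; vfield. Qed.

Lemma dot_volume_potential s a z :
  dot s (volume_potential (a *: s) z) = a / 2 * axis_dist2 s z.
Proof. by rewrite /axis_dist2 /volume_potential; vfield. Qed.

End Edges.

(** * Sums over a fundamental domain *)

Section Windows.
Variables (R : realType) (N : nat).
Implicit Types (k : int) (F : int -> 'cV[R]_3).

Lemma window_telescope F k :
  \sum_(1 <= i < N.+1) (F (k + i%:Z + 1) - F (k + i%:Z))
    = F (k + 1 + N%:Z) - F (k + 1).
Proof.
rewrite [RHS](_ : _ = F (k + N.+1%:Z) - F (k + 1%:Z)); last first.
  by rewrite -addrA -PoszD add1n.
rewrite -(@telescope_sumr _ _ _ (fun i => F (k + i%:Z))) //.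
by apply: eq_bigr => i _; rewrite -addrA -PoszD addn1.
Qed.

Lemma window_shift F k :
  \sum_(1 <= i < N.+1) F (k + 1 + i%:Z) =
    \sum_(1 <= i < N.+1) F (k + i%:Z) + (F (k + 1 + N%:Z) - F (k + 1)).
Proof.
rewrite -window_telescope -big_split; apply: eq_bigr => i _ /=.
by rewrite addrC subrK addrAC.
Qed.

Lemma cross_sumr c (I : Type) (r : seq I) (E : I -> 'cV[R]_3) :
  cross c (\sum_(i <- r) E i) = \sum_(i <- r) cross c (E i).
Proof.
apply: (big_morph (cross c)); [exact: crossDr | exact: crossv0].
Qed.

Lemma int_const (T : Type) (f : int -> T) :
  (forall k, f (k + 1) = f k) -> forall k, f k = f 0.
Proof.
move=> fS; elim=> // n IHn; first by rewrite -addn1 PoszD fS.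
by rewrite -IHn -fS -addn1 PoszD opprD subrK.
Qed.

End Windows.

Section AreaVolume.
Variables (R : realType) (N : nat) (g : SE3 R) (gamma : int -> 'cV[R]_3).
Hypothesis gammaP : quasi_periodic N g gamma.
Implicit Types (k : int) (h : SE3 R) (s : 'cV[R]_3).
Let P := rotpart g.
Let b := transpart g.

Let gammaE i : gamma (i + N%:Z) = P *m gamma i + b.
Proof. exact: gammaP. Qed.

(** * Change of the fundamental domain *)

Lemma area_on_shift k : let x := gamma (k + 1) in let y := gamma (k + 1 + 1) in
  area_on N g (k + 1) gamma = area_on N g k gamma
    + 2^-1 *: (P *m cross x y - cross x y + cross b (P *m (y - x) - (y - x))).
Proof.
rewrite /area_on (@window_shift _ _ (fun i => cross (gamma i) (gamma (i + 1)))).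
rewrite (addrAC (k + 1) N%:Z 1) !gammaE cross_edge_act ?rot_SO3 // -/b mulmxBr.
by move: (\sum_(_ <= _ < _) _) => S; vfield.
Qed.

(** The rotation [P] and the cross product with a multiple of [s] both
    leave no trace in the component along the fixed vector [s]. *)
Lemma dot_area_on_shift s a k : P *m s = s -> b = a *: s ->
  dot s (area_on N g (k + 1) gamma) = dot s (area_on N g k gamma).
Proof.
move=> Ps bs; rewrite area_on_shift bs; move: (area_on _ _ _ _) => S.
by rewrite !(dotDr, dotNr, dotZr) dot_rot_fixed ?rot_SO3 //; vfield.
Qed.

Lemma area_on_shift_translation k : P = 1%:M ->
  area_on N g (k + 1) gamma = area_on N g k gamma.
Proof.
by move=> P1; rewrite area_on_shift P1 !mul1mx !subrr crossv0 addr0 scaler0 addr0.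
Qed.

Lemma volume_on_shift k : let x := gamma (k + 1) in let y := gamma (k + 1 + 1) in
  volume_on N g (k + 1) gamma = volume_on N g k gamma
    + (3^-1 *: (P *m edge_volume x y - edge_volume x y
                + (3 / 2) *: cross b (P *m cross x y)
                + (volume_potential b (P *m y) - volume_potential b (P *m x)))
       - 6^-1 *: (cross y (cross b y) - cross x (cross b x))).
Proof.
rewrite /volume_on.
rewrite (@window_shift _ _ (fun i => edge_volume (gamma i) (gamma (i + 1)))).
rewrite (addrAC (k + 1) N%:Z 1) !gammaE edge_volume_act ?rot_SO3 // -/b.
rewrite -/(edge_volume (gamma (k + 1)) _).
move: (edge_volume _ _) (P *m edge_volume _ _) (\sum_(_ <= _ < _) _) => u v S.
move: (volume_potential _ _) (volume_potential _ _) => p q.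
by vfield.
Qed.

(** Along [s], the two potential differences reduce to differences of
    [axis_dist2 s], once with the factor [a / 6] from the new edge and once with
    [- a / 6] from the boundary term. *)
Lemma dot_volume_on_shift s a k : P *m s = s -> b = a *: s ->
  dot s (volume_on N g (k + 1) gamma) = dot s (volume_on N g k gamma).
Proof.
move=> Ps bs; have rP : SO3 P := rot_SO3 g.
rewrite volume_on_shift bs.
move: (volume_on _ _ _ _) (edge_volume _ _) => S u.
have pot z : dot s (volume_potential (a *: s) (P *m z))
    = a / 2 * axis_dist2 s z.
  by rewrite dot_volume_potential axis_dist2_rot.
move: (pot (gamma (k + 1))) (pot (gamma (k + 1 + 1))).
move: (volume_potential _ _) (volume_potential _ _) => p q dp dq.
rewrite !(dotDr, dotNr, dotZr) dot_rot_fixed // dp dq.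
by rewrite /axis_dist2; vfield.
Qed.

(** * Action of a rigid motion *)

Lemma area_act h : rotpart h *m b = b ->
  let c := transpart h in
  let z := rotpart h *m gamma 1 in let z' := rotpart h *m gamma (1 + N%:Z) in
  area N g (SE3_act h \o gamma) =
    rotpart h *m area N g gamma + 2^-1 *: cross c (z' - z + b).
Proof.
move=> hb c z z'; have rh := rot_SO3 h.
rewrite /area /area_on /= /SE3_act -/b.
under eq_bigr do rewrite cross_edge_act //.
rewrite big_split -mulmx_sumr /=.
rewrite (@window_telescope _ _ (fun i => cross c (rotpart h *m gamma i))).
rewrite !add0r mulmxBr -!scalemxAr -cross_rot // hb -/z -/z'.
by move: (rotpart h *m \sum_(_ <= _ < _) _) => S; vfield.
Qed.

(** The deviation of the volume vector from the coadjoint rule; [z] and [z']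
    stand for the rotated images of the first vertex and of its successor by
    one period. *)
Definition volume_defect b c z z' : 'cV[R]_3 :=
  3^-1 *: (volume_potential c z' - volume_potential c z)
  - 6^-1 *: (cross (z + c) (cross b (z + c)) - cross z (cross b z))
  + 2^-1 *: cross c (cross b z).

Lemma volume_act h : rotpart h *m b = b ->
  let c := transpart h in
  let z := rotpart h *m gamma 1 in let z' := rotpart h *m gamma (1 + N%:Z) in
  volume N g (SE3_act h \o gamma) =
    rotpart h *m volume N g gamma + cross c (rotpart h *m area N g gamma)
    + volume_defect b c z z'.
Proof.
move=> hb c z z'; have rh := rot_SO3 h.
rewrite /volume /volume_on /area /area_on /= /SE3_act -/b.
under eq_bigr do rewrite -/(edge_volume _ _) edge_volume_act //.
rewrite big_split /=.
rewrite (@window_telescope _ _ (fun i => volume_potential c (rotpart h *m gamma i))).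
rewrite big_split /= -scaler_sumr -cross_sumr -!mulmx_sumr.
rewrite !add0r !mulmxBr -!scalemxAr -!cross_rot // hb -/z -/z' -/c /volume_defect.
rewrite -/(edge_volume _ _).
move: (rotpart h *m \sum_(_ <= _ < _) cross (gamma _) _) => S.
rewrite -[\sum_(_ <= _ < _) cross (2^-1 *: _) _]/(\sum_(1 <= i < N.+1) edge_volume _ _).
move: (rotpart h *m \sum_(_ <= _ < _) _) => U.
move: (volume_potential _ _) (volume_potential _ _) => p q.
by vfield.
Qed.

End AreaVolume.

Section Defect.
Variable R : realType.
Implicit Types (a t : R) (s c z : 'cV[R]_3) (P : 'M[R]_3).

Lemma volume_defect_closed c z : volume_defect 0 c z z = 0.
Proof. by rewrite /volume_defect; vfield. Qed.

(** The terms containing [z] are all proportional to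
    [dot s s * dot z c - dot s z * dot s c]. Their coefficients, in units of [a],
    are [- 1/6] from the potentials, [- 1/3] from the boundary term and [1/2] from
    the last one, so they cancel. *)
Lemma dot_volume_defect_translation s a c z :
  dot s (volume_defect (a *: s) c z (z + a *: s))
    = - (2^-1 * a * axis_dist2 s c).
Proof. by rewrite /volume_defect /volume_potential /axis_dist2; vfield. Qed.

(** With both translations along [s], only squared distances to the axis
    contribute, and neither the monodromy nor the translation by [t *: s]
    changes the distance of [z] to the axis. *)
Lemma dot_volume_defect_screw P s a t z : SO3 P -> P *m s = s ->
  dot s (volume_defect (a *: s) (t *: s) z (P *m z + a *: s)) = 0.
Proof.
move=> rP Ps; rewrite /volume_defect.
have := dot_volume_potential s t z.
have := dot_volume_potential s t (P *m z + a *: s).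
rewrite axis_dist2_shift axis_dist2_rot //.
move: (volume_potential _ _) (volume_potential _ _) => p q dp dq.
rewrite !(dotDr, dotNr, dotZr) dp dq.
by rewrite /axis_dist2; vfield.
Qed.

End Defect.

Unset Implicit Arguments.

Theorem corollary4p1 (R : realType) (N : nat) (g : SE3 R)
    (gamma : int -> 'cV[R]_3) (s : 'cV[R]_3)
    (hN : (3 <= N)%N)
    (hgamma : quasi_periodic N g gamma)
    (hg : ~ pure_half_turn g)
    (horigin : rotpart g <> 1%:M -> rotpart g *m transpart g = transpart g)
    (hs : screw_direction g s) :
  let A := area N g in
  let V := volume N g in
  [/\ g = 1%g ->
      [/\ forall k : int, area_on N g k gamma = A gamma /\ volume_on N g k gamma = V gamma,
          forall h : SE3 R, centralizer g h &
          forall h : SE3 R, let y := SE3_act h \o gamma in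
          [/\ A y = rotpart h *m A gamma,
              V y = rotpart h *m V gamma + cross (transpart h) (rotpart h *m A gamma) &
              (V y, A y) = coadjoint h (V gamma, A gamma)]],

      rotpart g = 1%:M -> transpart g <> 0 ->
      [/\ forall k : int, area_on N g k gamma = A gamma /\
            dot s (volume_on N g k gamma) = dot s (V gamma),
          forall h : SE3 R, centralizer g h <-> rotpart h *m s = s &
          forall h : SE3 R, centralizer g h ->
          let y := SE3_act h \o gamma in
          let c := transpart h in
          [/\ A y = rotpart h *m A gamma + cross c (transpart g),
              dot s (V y) = dot s (rotpart h *m V gamma + cross c (rotpart h *m A gamma))
                - 2^-1 * enorm (transpart g) * enorm (perp_part s c) ^+ 2 &
              parallel c s -> cross c (transpart g) = 0 /\
                - (2^-1 * enorm (transpart g) * enorm (perp_part s c) ^+ 2) = 0]] &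

      rotpart g <> 1%:M ->
      [/\ forall k : int, dot s (area_on N g k gamma) = dot s (A gamma) /\
            dot s (volume_on N g k gamma) = dot s (V gamma),
          forall h : SE3 R, centralizer g h ->
            rotpart h *m s = s /\ parallel (transpart h) s &
          forall h : SE3 R, centralizer g h ->
          let y := SE3_act h \o gamma in
          dot s (A y) = dot s (rotpart h *m A gamma) /\
          dot s (V y) =
            dot s (rotpart h *m V gamma + cross (transpart h) (rotpart h *m A gamma))]].
Proof.
move=> /=.
have rg := rot_SO3 g.
split.
- move=> g1.
  have P1 : rotpart g = 1%:M by rewrite g1.
  have b0 : transpart g = 0 by rewrite g1.
  have period h : rotpart h *m gamma (1 + N%:Z) = rotpart h *m gamma 1.
    by rewrite hgamma /SE3_act P1 b0 mul1mx addr0.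
  have hb (h : SE3 R) : rotpart h *m transpart g = transpart g.
    by rewrite b0 mulmx0.
  have areaE (h : SE3 R) :
      area N g (SE3_act h \o gamma) = rotpart h *m area N g gamma.
    by rewrite area_act // period b0 subrr addr0 crossv0 scaler0 addr0.
  have volumeE (h : SE3 R) : volume N g (SE3_act h \o gamma) =
      rotpart h *m volume N g gamma
      + cross (transpart h) (rotpart h *m area N g gamma).
    by rewrite volume_act // period b0 volume_defect_closed addr0.
  split.
  + move=> k; split.
      apply: (@int_const _ (fun k => area_on N g k gamma)) => {}k.
      exact: area_on_shift_translation.
    (* Without translation part, every vector is fixed and may serve as axis. *)
    apply: dot_ext => w.
    apply: (@int_const _ (fun k => dot w (volume_on N g k gamma))) => {}k.
    by apply: (@dot_volume_on_shift _ _ _ _ hgamma w 0);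
      rewrite ?P1 ?mul1mx ?b0 ?scale0r.
  + by move=> h; rewrite /centralizer /= /commute g1 mulg1 mul1g.
  + by move=> h; split; rewrite ?/coadjoint /= ?areaE ?volumeE.
- move=> P1 b0.
  have sE := hs.2 P1 b0.
  have nb0 : enorm (transpart g) != 0.
    by apply/eqP => n0; apply: b0; apply: dotv_eq0; rewrite -sqr_enorm n0 expr0n.
  have bs : transpart g = enorm (transpart g) *: s.
    by rewrite sE scalerA divff ?scale1r.
  have s1 : dot s s = 1.
    (* Both sides times the squared norm of the translation vector. *)
    apply: (mulfI (expf_neq0 2 nb0)); rewrite mulr1 [RHS]sqr_enorm [in RHS]bs.
    by vfield.
  have cent h : centralizer g h <-> rotpart h *m s = s.
    rewrite centralizer_translation // bs -scalemxAr.
    by split=> [/(scalerI nb0)|->].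
  split=> //.
  + move=> k; split.
      apply: (@int_const _ (fun k => area_on N g k gamma)) => {}k.
      exact: area_on_shift_translation.
    apply: (@int_const _ (fun k => dot s (volume_on N g k gamma))) => {}k.
    by apply: (dot_volume_on_shift hgamma _ _ bs); rewrite P1 mul1mx.
  + move=> h /cent hs1; set c := transpart h.
    have hb : rotpart h *m transpart g = transpart g.
      by rewrite bs -scalemxAr hs1.
    have period : rotpart h *m gamma (1 + N%:Z) = rotpart h *m gamma 1 + transpart g.
      by rewrite hgamma /SE3_act P1 mul1mx mulmxDr hb.
    have perpE : enorm (perp_part s c) ^+ 2 = axis_dist2 s c.
      rewrite sqr_enorm axis_dist2E s1 mul1r /perp_part.
      have -> : dot (c - dot s c *: s) (c - dot s c *: s) =
        dot c c - 2 * dot s c ^+ 2 + dot s c ^+ 2 * dot s s by vfield.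
      by rewrite s1; ring.
    split.
    * rewrite area_act // period [_ + transpart g - _]addrC addKr -/c.
      by rewrite -mulr2n -scaler_nat crossZr scalerA mulVf ?scale1r ?pnatr_eq0.
    * rewrite volume_act // period perpE dotDr -/c; congr (_ + _).
      by rewrite {1 2}bs dot_volume_defect_translation.
    * case=> a ca; split; first by rewrite ca bs; vfield.
      rewrite perpE axis_dist2E ca.
      have -> : dot s s * dot (a *: s) (a *: s) - dot s (a *: s) ^+ 2 = 0 by vfield.
      by rewrite mulr0 oppr0.
- move=> P1.
  have [ns Ps] := hs.1 P1.
  have s1 : dot s s = 1 by rewrite -sqr_enorm ns expr1n.
  have bs := rot_fixed_axis rg P1 s1 Ps (horigin P1).
  have cent h := centralizer_screw hg P1 (horigin P1) ns Ps (h := h).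
  split=> //.
  + move=> k; split.
      apply: (@int_const _ (fun k => dot s (area_on N g k gamma))) => {}k.
      exact: (dot_area_on_shift hgamma _ Ps bs).
    apply: (@int_const _ (fun k => dot s (volume_on N g k gamma))) => {}k.
    exact: (dot_volume_on_shift hgamma _ Ps bs).
  + move=> h hc; have [hs1 [t ct]] := cent h hc.
    have hb : rotpart h *m transpart g = transpart g.
      by rewrite bs -scalemxAr hs1.
    have period : rotpart h *m gamma (1 + N%:Z)
        = rotpart g *m (rotpart h *m gamma 1) + transpart g.
      have [hP _] := (centralizerP g h).1 hc.
      by rewrite hgamma /SE3_act mulmxDr hb !mulmxA hP.
    split.
    * rewrite area_act // ct dotDr dotZr.
      have -> w : dot s (cross (t *: s) w) = 0 by vfield.
      by rewrite mulr0 addr0.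
    * rewrite volume_act // period ct dotDr {1 2}bs.
      by rewrite dot_volume_defect_screw // addr0.
Qed.
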